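(* Let $R$ be a commutative ring. The class of strongly semisimple Hopf algebras over $R$ is closed under Drinfeld twists: if $H$ is a strongly semisimple Hopf algebra over $R$ and $J\in H\otimes_R H$ is a Drinfeld twist for $H$, then the twisted Hopf algebra $H^J$ is strongly semisimple.
   Context: All rings are associative with unit. For a Hopf algebra $H$ over $R$ with comultiplication $\Delta(h)=\sum_{(h)}h_1\otimes h_2$, counit $\varepsilon$ and antipode $S$, a left $H$-module algebra is a unital $R$-algebra $A$ that is a left $H$-module with $h\cdot(ab)=\sum_{(h)}(h_1\cdot a)(h_2\cdot b)$ and $h\cdot 1_A=\varepsilon(h)1_A$. The smash product $A\# H$ is the $R$-algebra with underlying module $A\otimes_R H$ and multiplication $(a\# h)(b\# g)=\sum_{(h)}a(h_1\cdot b)\# h_2g$. $A$ is $H$-semiprime if it contains no non-zero nilpotent $H$-stable two-sided ideals. $H$ is strongly semisimple if for every $H$-semiprime left $H$-module algebra $A$ the smash product $A\# H$ is semiprime (has no non-zero nilpotent ideals). A Drinfeld twist for $H$ is an invertible element $J\in H\otimes H$ such that $(J\otimes 1)(\Delta\otimes 1)(J)=(1\otimes J)(1\otimes\Delta)(J)$ and $(\varepsilon\otimes 1)(J)=1=(1\otimes\varepsilon)(J)$. Writing $J=\sum J^1\otimes J^2$, $J^{-1}=\sum Q^1\otimes Q^2$, $U=\sum J^1S(J^2)$, $U^{-1}=\sum S(Q^1)Q^2$, the Hopf algebra $H^J$ has the same multiplication, unit and counit as $H$, with comultiplication $\Delta^J(h)=J\Delta(h)J^{-1}$ and antipode $S^J(h)=US(h)U^{-1}$.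 *)

(* Defs.v *)
From HB Require Import structures.
From mathcomp Require Import all_boot all_algebra.
From mathcomp Require Import generic_quotient boolp.

Set Implicit Arguments.
Unset Strict Implicit.
Unset Printing Implicit Defensive.

Import GRing.Theory.
Local Open Scope ring_scope.

Section Linear.
Variable R : comPzRingType.

Definition is_lin (U V : lmodType R) (f : U -> V) : Prop :=
  (forall x y, f (x + y) = f x + f y) /\ (forall a x, f (a *: x) = a *: f x).

Definition is_bilin (U V W : lmodType R) (f : U -> V -> W) : Prop :=
  (forall v, is_lin (f^~ v)) /\ (forall u, is_lin (f u)).

Implicit Types U V W : lmodType R.

Lemma lin0 U V (f : U -> V) : is_lin f -> f 0 = 0.
Proof. by case=> _ fZ; rewrite -(scale0r 0) fZ scale0r. Qed.

Lemma lin_sum U V (f : U -> V) I (r : seq I) (F : I -> U) : is_lin f ->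
  f (\sum_(i <- r) F i) = \sum_(i <- r) f (F i).
Proof.
move=> lf; elim: r => [|i r IH]; first by rewrite !big_nil lin0.
by rewrite !big_cons (proj1 lf) IH.
Qed.

Lemma lin_id U : is_lin (fun x : U => x).
Proof. by []. Qed.

Lemma lin_linear U V W (f : {linear V -> W}) (g : U -> V) :
  is_lin g -> is_lin (fun x => f (g x)).
Proof. by case=> gD gZ; split=> *; rewrite (gD, gZ) (linearD, linearZ). Qed.

Lemma lin_comp U V W (f : V -> W) (g : U -> V) :
  is_lin f -> is_lin g -> is_lin (fun x => f (g x)).
Proof. by move=> [fD fZ] [gD gZ]; split=> *; rewrite ?(gD, gZ) (fD, fZ). Qed.

Lemma lin_scale U V a (g : U -> V) : is_lin g -> is_lin (fun x => a *: g x).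
Proof.
case=> gD gZ; split=> *; rewrite (gD, gZ) ?scalerDr //.
by rewrite !scalerA mulrC.
Qed.

Lemma lin_scalar U V W (f : {scalar V}) (w : W) (g : U -> V) :
  is_lin g -> is_lin (fun x => f (g x) *: w).
Proof.
case=> gD gZ; split=> *; rewrite (gD, gZ) (linearD, linearZ) /= ?scalerDl //.
by rewrite scalerA.
Qed.

Lemma bilin_l U V W (f : U -> V -> W) v : is_bilin f -> is_lin (f^~ v).
Proof. by case. Qed.

Lemma bilin_r U V W (f : U -> V -> W) u : is_bilin f -> is_lin (f u).
Proof. by case. Qed.

End Linear.

(* MathComp has no tensor product of modules.  U (x) V is presented as the     *)
(* quotient of formal finite sums of pairs (lists) by the least congruence    *)
(* that is commutative and bilinear.                                          *)
Section TensorModule.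
Variables (R : comPzRingType) (U V : lmodType R).

Inductive tens_rel : seq (U * V) -> seq (U * V) -> Prop :=
| TensRefl s : tens_rel s s
| TensSym s t : tens_rel s t -> tens_rel t s
| TensTrans s t u : tens_rel s t -> tens_rel t u -> tens_rel s u
| TensCat s s' t t' :
    tens_rel s s' -> tens_rel t t' -> tens_rel (s ++ t) (s' ++ t')
| TensC s t : tens_rel (s ++ t) (t ++ s)
| TensDl u u' v : tens_rel [:: (u + u', v)] [:: (u, v); (u', v)]
| TensDr u v v' : tens_rel [:: (u, v + v')] [:: (u, v); (u, v')]
| TensZ a u v : tens_rel [:: (a *: u, v)] [:: (u, a *: v)]
| Tens0 v : tens_rel [:: (0, v)] [::].

Definition tens_relb (s t : seq (U * V)) : bool := `[< tens_rel s t >].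

Lemma tens_relb_refl : reflexive tens_relb.
Proof. by move=> s; apply/asboolP; apply: TensRefl. Qed.

Lemma tens_relb_sym : symmetric tens_relb.
Proof. by move=> s t; apply/asboolP/asboolP; apply: TensSym. Qed.

Lemma tens_relb_trans : transitive tens_relb.
Proof.
by move=> t s u /asboolP st /asboolP tu; apply/asboolP; apply: TensTrans tu.
Qed.

Canonical tens_equiv :=
  EquivRel tens_relb tens_relb_refl tens_relb_sym tens_relb_trans.

Definition tens : Type := {eq_quot tens_equiv}%qT.
HB.instance Definition _ := Choice.copy tens {eq_quot tens_equiv}%qT.

Definition tcl (s : seq (U * V)) : tens := (\pi_({eq_quot tens_equiv}) s)%qT.
Definition trep (t : tens) : seq (U * V) :=
  repr (t : {eq_quot tens_equiv}%qT).

Lemma trepK t : tcl (trep t) = t.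
Proof. exact: reprK. Qed.

Lemma tclP s t : tcl s = tcl t <-> tens_rel s t.
Proof.
split=> [/eqP|st]; first by rewrite /tcl eqmodE => /asboolP.
by apply/eqP; rewrite /tcl eqmodE; apply/asboolP.
Qed.

Lemma trep_rel s : tens_rel (trep (tcl s)) s.
Proof. by apply/tclP; rewrite trepK. Qed.

Definition pure (u : U) (v : V) : tens := tcl [:: (u, v)].

Definition tens_zero : tens := tcl [::].
Definition tens_add (s t : tens) : tens := tcl (trep s ++ trep t).
Definition tens_scale (a : R) (t : tens) : tens :=
  tcl [seq (a *: p.1, p.2) | p <- trep t].
Definition tens_opp (t : tens) : tens := tens_scale (-1) t.

Lemma tens_addE s t : tens_add (tcl s) (tcl t) = tcl (s ++ t).
Proof. by apply/tclP; apply: TensCat; apply: trep_rel. Qed.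

Lemma tens_scaleE a s :
  tens_scale a (tcl s) = tcl [seq (a *: p.1, p.2) | p <- s].
Proof.
apply/tclP; move: (trep_rel s); move: (trep _) => r; elim=> {r s} /=.

- by move=> s; apply: TensRefl.
- by move=> s t _; apply: TensSym.
- by move=> s t u _ st _; apply: TensTrans.
- by move=> s s' t t' _ ss' _ tt'; rewrite !map_cat; apply: TensCat.
- by move=> s t; rewrite !map_cat; apply: TensC.
- by move=> u u' v; rewrite scalerDr; apply: TensDl.
- by move=> u v v'; apply: TensDr.
- move=> b u v; rewrite scalerA mulrC -scalerA; exact: TensZ.
- by move=> v; rewrite scaler0; apply: Tens0.
Qed.

Lemma tens_addA : associative tens_add.
Proof.
move=> s t u; rewrite -(trepK s) -(trepK t) -(trepK u).
by rewrite !tens_addE catA.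
Qed.

Lemma tens_addC : commutative tens_add.
Proof.
move=> s t; rewrite -(trepK s) -(trepK t) !tens_addE.
by apply/tclP; apply: TensC.
Qed.

Lemma tens_add0 : left_id tens_zero tens_add.
Proof. by move=> t; rewrite -(trepK t) tens_addE. Qed.

Lemma tens_scaleDl t a b :
  tens_scale (a + b) t = tens_add (tens_scale a t) (tens_scale b t).
Proof.
rewrite -(trepK t) !tens_scaleE tens_addE; apply/tclP.
elim: (trep t) => [|[u v] s IH] /=; first exact: TensRefl.
apply: (@TensTrans _ ([:: (a *: u, v); (b *: u, v)] ++
   ([seq (a *: p.1, p.2) | p <- s] ++ [seq (b *: p.1, p.2) | p <- s]))).
  rewrite -cat1s; apply: TensCat => //.
  by rewrite scalerDl; apply: TensDl.
rewrite -[X in tens_rel X _]/([:: (a *: u, v)] ++ ([:: (b *: u, v)] ++ _)).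
rewrite -[X in tens_rel _ X]/([:: (a *: u, v)] ++ (_ ++ ([:: (b *: u, v)] ++ _))).
apply: TensCat; first exact: TensRefl.
by rewrite !catA; apply: TensCat; [apply: TensC | apply: TensRefl].
Qed.

Lemma tens_scale0 t : tens_scale 0 t = tens_zero.
Proof.
rewrite -(trepK t) tens_scaleE; apply/tclP.
elim: (trep t) => [|[u v] s IH] /=; first exact: TensRefl.
by rewrite scale0r -cat1s -[[::]]/([::] ++ [::]);
  apply: TensCat => //; apply: Tens0.
Qed.

Lemma tens_scale1 : left_id 1 tens_scale.
Proof.
move=> t; rewrite -{1}(trepK t) tens_scaleE -[RHS]trepK; congr tcl.
by rewrite -[RHS]map_id; apply: eq_map => -[u v] /=; rewrite scale1r.
Qed.

Lemma tens_addN : left_inverse tens_zero tens_opp tens_add.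
Proof.
move=> t; rewrite -[X in tens_add _ X]tens_scale1 /tens_opp.
by rewrite -tens_scaleDl addNr tens_scale0.
Qed.

HB.instance Definition _ :=
  GRing.isZmodule.Build tens tens_addA tens_addC tens_add0 tens_addN.

Lemma tens_scaleA a b t : tens_scale a (tens_scale b t) = tens_scale (a * b) t.
Proof.
rewrite -(trepK t) !tens_scaleE -map_comp; congr tcl.
by apply: eq_map => -[u v] /=; rewrite scalerA.
Qed.

Lemma tens_scaleDr : right_distributive tens_scale +%R.
Proof.
move=> a s t; rewrite -(trepK s) -(trepK t) [_ + _]tens_addE.
by rewrite !tens_scaleE map_cat -tens_addE.
Qed.

HB.instance Definition _ := GRing.Zmodule_isLmodule.Build R tens
  tens_scaleA tens_scale1 tens_scaleDr tens_scaleDl.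

End TensorModule.

Notation "u \ot v" := (pure u v) (at level 45, left associativity).

Section TensorUniversal.
Variable R : comPzRingType.
Implicit Types U V W X : lmodType R.

(* Sweedler-style summation: if t = \sum_i u_i \ot v_i then                   *)
(* tsum t f = \sum_i f u_i v_i.  It is computed on a chosen decomposition of  *)
(* t, and is independent of it when f is bilinear (tsum_tcl).                 *)
Definition tsum U V W (t : tens U V) (f : U -> V -> W) : W :=
  \sum_(p <- trep t) f p.1 p.2.

Lemma tsum_tcl U V W (f : U -> V -> W) s : is_bilin f ->
  tsum (tcl s) f = \sum_(p <- s) f p.1 p.2.
Proof.
case=> fl fr; rewrite /tsum.
move: (trep_rel s); move: (trep _) => r; elim=> {r s} //=.
- by move=> s t u _ -> _ ->.
- by move=> s s' t t' _ e _ e'; rewrite !big_cat /= e e'.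
- by move=> s t; rewrite !big_cat /= addrC.
- by move=> u u' v; rewrite !big_cons !big_nil !addr0 (proj1 (fl v)).
- by move=> u v v'; rewrite !big_cons !big_nil !addr0 (proj1 (fr u)).
- move=> a u v; rewrite !big_cons !big_nil !addr0.
  by rewrite (proj2 (fl v)) (proj2 (fr u)).
- by move=> v; rewrite !big_cons !big_nil !addr0 (lin0 (fl v)).
Qed.

Lemma tsum_pure U V W (f : U -> V -> W) u v : is_bilin f ->
  tsum (u \ot v) f = f u v.
Proof. by move=> bf; rewrite tsum_tcl // big_cons big_nil addr0. Qed.

Lemma tsum_lin U V W (f : U -> V -> W) : is_bilin f -> is_lin (fun t => tsum t f).
Proof.
move=> bf; split=> [s t|a t].
  rewrite -[s + t]/(tens_add s t) /tens_add tsum_tcl //.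
  by rewrite big_cat /=.
rewrite -[a *: t]/(tens_scale a t) /tens_scale tsum_tcl // big_map.
rewrite /tsum scaler_sumr; apply: eq_bigr => q _ /=.
by rewrite (proj2 (bf.1 _)).
Qed.

Lemma pure_bilin U V : is_bilin (@pure R U V).
Proof.
split=> [v|u]; split=> *; rewrite /pure.
- by rewrite -[RHS]/(tens_add _ _) tens_addE; apply/tclP; apply: TensDl.
- by rewrite -[RHS]/(tens_scale _ _) tens_scaleE.
- by rewrite -[RHS]/(tens_add _ _) tens_addE; apply/tclP; apply: TensDr.
- rewrite -[RHS]/(tens_scale _ _) tens_scaleE /=.
  by apply/tclP; apply: TensSym; apply: TensZ.
Qed.

Lemma tens_decomp U V (t : tens U V) : t = \sum_(p <- trep t) (p.1 \ot p.2).
Proof.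
rewrite -{1}(trepK t); elim: (trep t) => [|[u v] s IH].
  by rewrite big_nil.
rewrite big_cons -IH /= /pure -[RHS]/(tens_add _ _).
by rewrite tens_addE.
Qed.

Lemma lin_ext U V W (f g : tens U V -> W) : is_lin f -> is_lin g ->
  (forall u v, f (u \ot v) = g (u \ot v)) -> forall t, f t = g t.
Proof.
move=> lf lg fg t; rewrite (tens_decomp t) !lin_sum //.
by apply: eq_bigr => q _.
Qed.

Lemma lin_tsum U V W (f : tens U V -> W) t : is_lin f ->
  f t = tsum t (fun u v => f (u \ot v)).
Proof. by move=> lf; rewrite {1}(tens_decomp t) lin_sum.
Qed.

Lemma tsum_id U V (t : tens U V) : tsum t (@pure R U V) = t.
Proof. by rewrite [RHS]tens_decomp. Qed.

Lemma eq_tsum U V W (f g : U -> V -> W) t :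
  (forall u v, f u v = g u v) -> tsum t f = tsum t g.
Proof. by move=> fg; apply: eq_bigr => q _. Qed.

Lemma tsum_comm U V U' V' W (F : U -> V -> U' -> V' -> W) s t :
  tsum s (fun u v => tsum t (F u v)) =
  tsum t (fun u' v' => tsum s (fun u v => F u v u' v')).
Proof. exact: exchange_big. Qed.

Lemma lin_tsum_comp U V W X (f : W -> X) (F : U -> V -> W) t : is_lin f ->
  f (tsum t F) = tsum t (fun u v => f (F u v)).
Proof. by move=> lf; rewrite lin_sum.
Qed.

Lemma lin_tsum_arg U V W X (f : U -> V -> W) (g : X -> tens U V) :
  is_bilin f -> is_lin g -> is_lin (fun x => tsum (g x) f).
Proof. by move=> bf lg; exact: (lin_comp (tsum_lin bf)). Qed.

Lemma lin_tsum_fun U V W X (F : X -> U -> V -> W) t :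
  (forall u v, is_lin (fun x => F x u v)) -> is_lin (fun x => tsum t (F x)).
Proof.
move=> lF; rewrite /tsum; split=> [x y|a x].
  by rewrite -big_split; apply: eq_bigr => q _; rewrite (proj1 (lF _ _)).
by rewrite scaler_sumr; apply: eq_bigr => q _; rewrite (proj2 (lF _ _)).
Qed.

Lemma lin_pure_l U V X (g : X -> U) (v : V) :
  is_lin g -> is_lin (fun x => g x \ot v).
Proof. exact: (lin_comp ((pure_bilin U V).1 v)). Qed.

Lemma lin_pure_r U V X (u : U) (g : X -> V) :
  is_lin g -> is_lin (fun x => u \ot g x).
Proof. exact: (lin_comp ((pure_bilin U V).2 u)). Qed.

Definition tmap U V U' V' (f : U -> U') (g : V -> V') (t : tens U V) :
  tens U' V' := tsum t (fun u v => f u \ot g v).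

Definition tassoc U V W (t : tens (tens U V) W) : tens U (tens V W) :=
  tsum t (fun s w => tsum s (fun u v => u \ot (v \ot w))).

End TensorUniversal.

(* The library's algType is restricted to non-zero rings, which excludes      *)
(* e.g. the tensor product of two arbitrary algebras; this is the structure   *)
(* of possibly zero unital associative R-algebras.                            *)
HB.mixin Record isPzAlgebra (R : comPzRingType) A of GRing.Lmodule R A := {
  pzone : A;
  pzmul : A -> A -> A;
  pzmulA : associative pzmul;
  pzmul1l : left_id pzone pzmul;
  pzmul1r : right_id pzone pzmul;
  pzmulDl : left_distributive pzmul +%R;
  pzmulDr : right_distributive pzmul +%R;
  pzscalAl : forall (a : R) (x y : A), a *: pzmul x y = pzmul (a *: x) y;
  pzscalAr : forall (a : R) (x y : A), a *: pzmul x y = pzmul x (a *: y)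
}.

#[short(type="pzAlgType")]
HB.structure Definition PzAlgebra (R : comPzRingType) :=
  { A of GRing.Lmodule R A & isPzAlgebra R A }.

HB.instance Definition _ (R : comPzRingType) (A : pzAlgType R) :=
  GRing.Zmodule_isPzRing.Build (PzAlgebra.sort A)
    (@pzmulA R A) (@pzmul1l R A) (@pzmul1r R A)
    (@pzmulDl R A) (@pzmulDr R A).
Section PzAlgebraTheory.
Variables (R : comPzRingType) (A : pzAlgType R).

Lemma scal_mull (a : R) (x y : A) : (a *: x) * y = a *: (x * y).
Proof. exact/esym/pzscalAl. Qed.

Lemma scal_mulr (a : R) (x y : A) : x * (a *: y) = a *: (x * y).
Proof. exact/esym/pzscalAr. Qed.

Lemma lin_mull (X : lmodType R) (c : A) (g : X -> A) :
  is_lin g -> is_lin (fun x => c * g x).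
Proof. by case=> gD gZ; split=> *; rewrite (gD, gZ) ?mulrDr ?scal_mulr. Qed.

Lemma lin_mulr (X : lmodType R) (c : A) (g : X -> A) :
  is_lin g -> is_lin (fun x => g x * c).
Proof. by case=> gD gZ; split=> *; rewrite (gD, gZ) ?mulrDl ?scal_mull. Qed.

End PzAlgebraTheory.

(* Solves linearity and bilinearity side conditions. *)
Ltac lin_extra := fail.
Ltac lin_step :=
  cbv beta;
  lazymatch goal with
  | |- forall _, _ => intro
  | |- is_bilin _ => first [assumption | exact: pure_bilin | split; intro]
  | |- is_lin (fun x => x) => exact: lin_id
  | |- is_lin (fun x => _) => first
      [ assumption
      | apply: lin_tsum_fun | apply: lin_tsum_arg
      | apply: lin_pure_l | apply: lin_pure_r
      | apply: lin_mull | apply: lin_mulr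
      | apply: lin_scale | apply: lin_scalar
      | apply: lin_linear
      | lin_extra
      | match goal with
        | H : is_lin ?f |- is_lin (fun x => ?f (@?g x)) =>
            apply: (lin_comp (g := g) H)
        | H : is_bilin ?f |- is_lin (fun x => ?f (@?g x) ?v) =>
            apply: (lin_comp (g := g) (bilin_l v H))
        | H : is_bilin ?f |- is_lin (fun x => ?f ?u (@?g x)) =>
            apply: (lin_comp (g := g) (bilin_r u H))
        | H : forall _ _, is_lin _ |- _ => apply: (lin_comp (H _ _))
        end ]
  | |- is_lin ?f => first [assumption | change (is_lin (fun x => f x))]
  end.
Ltac lin := solve [repeat lin_step].

Section TensorAlgebra.
Variables (R : comPzRingType) (A B : pzAlgType R).

Definition tens_one : tens A B := (1 : A) \ot (1 : B).
Definition tens_mul (s t : tens A B) : tens A B :=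
  tsum s (fun a b => tsum t (fun a' b' => (a * a') \ot (b * b'))).

Lemma tens_mul_bilin : is_bilin tens_mul.
Proof. by rewrite /tens_mul; lin. Qed.

Lemma tens_mulE a b a' b' :
  tens_mul (a \ot b) (a' \ot b') = (a * a') \ot (b * b').
Proof. by rewrite /tens_mul !tsum_pure //; lin. Qed.

Lemma tens_mulA : associative tens_mul.
Proof.
have bm := tens_mul_bilin.
move=> s t u; move: s; apply: lin_ext; [lin|lin|move=> a b].
move: t; apply: lin_ext; [lin|lin|move=> a' b'].
move: u; apply: lin_ext; [lin|lin|move=> a2 b2].
by rewrite !tens_mulE !mulrA.
Qed.

Lemma tens_mul1l : left_id tens_one tens_mul.
Proof.
have bm := tens_mul_bilin.
by apply: lin_ext; [lin|lin|move=> a b]; rewrite tens_mulE !mul1r.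
Qed.

Lemma tens_mul1r : right_id tens_one tens_mul.
Proof.
have bm := tens_mul_bilin.
by apply: lin_ext; [lin|lin|move=> a b]; rewrite tens_mulE !mulr1.
Qed.

Lemma tens_mulDl : left_distributive tens_mul +%R.
Proof. by move=> s t u; rewrite (proj1 (bilin_l u tens_mul_bilin)). Qed.

Lemma tens_mulDr : right_distributive tens_mul +%R.
Proof. by move=> u s t; rewrite (proj1 (bilin_r u tens_mul_bilin)). Qed.

Lemma tens_scalAl (a : R) s t : a *: tens_mul s t = tens_mul (a *: s) t.
Proof. by rewrite (proj2 (bilin_l t tens_mul_bilin)). Qed.

Lemma tens_scalAr (a : R) s t : a *: tens_mul s t = tens_mul s (a *: t).
Proof. by rewrite (proj2 (bilin_r s tens_mul_bilin)). Qed.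

HB.instance Definition _ := isPzAlgebra.Build R (tens A B)
  tens_mulA tens_mul1l tens_mul1r tens_mulDl tens_mulDr
  tens_scalAl tens_scalAr.
HB.instance Definition _ :=
  GRing.PzRing.copy (tens A B) (PzAlgebra.sort (tens A B : pzAlgType R)).

Lemma pureM a b a' b' :
  (a \ot b) * (a' \ot b') = (a * a') \ot (b * b') :> tens A B.
Proof. exact: tens_mulE. Qed.

Lemma pure1 : (1 : A) \ot (1 : B) = 1.
Proof. by []. Qed.

End TensorAlgebra.

Record hopfAlg (R : comPzRingType) := HopfAlg {
  hopf_alg :> pzAlgType R;
  comul : {linear hopf_alg -> tens hopf_alg hopf_alg};
  counit : {scalar hopf_alg};
  antipode : {linear hopf_alg -> hopf_alg};
  comul1 : comul 1 = 1;
  comulM : {morph comul : g h / g * h};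
  counit1 : counit 1 = 1;
  counitM : {morph counit : g h / g * h};
  comulA : forall h,
    tassoc (tmap comul id (comul h)) = tmap id comul (comul h);
  counit_l : forall h, tsum (comul h) (fun h1 h2 => counit h1 *: h2) = h;
  counit_r : forall h, tsum (comul h) (fun h1 h2 => counit h2 *: h1) = h;
  antipode_l : forall h,
    tsum (comul h) (fun h1 h2 => antipode h1 * h2) = counit h *: (1 : hopf_alg);
  antipode_r : forall h,
    tsum (comul h) (fun h1 h2 => h1 * antipode h2) = counit h *: (1 : hopf_alg)
}.

Arguments comul {R H} : rename.
Arguments counit {R H} : rename.
Arguments antipode {R H} : rename.

Lemma tsum_mul (R : comPzRingType) (A B : pzAlgType R) (W : lmodType R)
    (s t : tens A B) (F : A -> B -> W) : is_bilin F ->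
  tsum (s * t) F =
  tsum s (fun a b => tsum t (fun a' b' => F (a * a') (b * b'))).
Proof.
move=> bF; rewrite -[s * t]/(tens_mul s t) /tens_mul.
rewrite (lin_tsum_comp (f := fun t => tsum t F)); last by lin.
apply: eq_tsum => a b.
rewrite (lin_tsum_comp (f := fun t => tsum t F)); last by lin.
by apply: eq_tsum => a' b'; rewrite tsum_pure.
Qed.

Section HopfTheory.
Variables (R : comPzRingType) (H : hopfAlg R).
Implicit Types (g h : H) (W : lmodType R).
Local Notation S := (@antipode R H).

Lemma comul_assoc W (F : H -> H -> H -> W) h :
  (forall v w, is_lin (fun u => F u v w)) ->
  (forall u w, is_lin (fun v => F u v w)) ->
  (forall u v, is_lin (fun w => F u v w)) ->
  tsum (comul h) (fun x w => tsum (comul x) (fun u v => F u v w)) =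
  tsum (comul h) (fun u x => tsum (comul x) (fun v w => F u v w)).
Proof.
move=> F1 F2 F3.
pose L (t : tens H (tens H H)) := tsum t (fun u s => tsum s (F u)).
have bF u : is_bilin (F u) by lin.
have lL : is_lin L by rewrite /L; lin.
transitivity (L (tmap id comul (comul h))); last first.
  rewrite /tmap (lin_tsum_comp (f := L)) //.
  by apply: eq_tsum => u x; rewrite /L tsum_pure //; lin.
rewrite -comulA /tmap /tassoc.
rewrite (lin_tsum_comp (f := fun t => L (tsum t _))); last by rewrite /L; lin.
apply: eq_tsum => x w; rewrite tsum_pure; last by lin.
rewrite (lin_tsum_comp (f := L)) //.
apply: eq_tsum => u v; rewrite /L tsum_pure; last by lin.
by rewrite tsum_pure; last by lin.
Qed.

Lemma counit_lF W (F : H -> W) h : is_lin F ->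
  tsum (comul h) (fun h1 h2 => counit h1 *: F h2) = F h.
Proof.
move=> lF; rewrite -[in RHS](counit_l h) (lin_tsum_comp (f := F)) //.
by apply: eq_tsum => x y; rewrite (proj2 lF).
Qed.

Lemma counit_rF W (F : H -> W) h : is_lin F ->
  tsum (comul h) (fun h1 h2 => counit h2 *: F h1) = F h.
Proof.
move=> lF; rewrite -[in RHS](counit_r h) (lin_tsum_comp (f := F)) //.
by apply: eq_tsum => x y; rewrite (proj2 lF).
Qed.

Lemma antipode1 : S 1 = 1.
Proof.
have := antipode_l (1 : H); rewrite comul1 counit1 scale1r -pure1.
by rewrite tsum_pure ?mulr1 //; lin.
Qed.

(* Both sides equal \sum S(g1 h1) g2 h2 S(h3) S(g3).                          *)
Lemma antipodeM g h : S (g * h) = S h * S g.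
Proof.
transitivity (tsum (comul g) (fun x g3 => tsum (comul x) (fun g1 g2 =>
  tsum (comul h) (fun y h3 => tsum (comul y) (fun h1 h2 =>
    S (g1 * h1) * (g2 * h2) * S h3 * S g3))))).
  rewrite (comul_assoc (F := fun g1 g2 g3 =>
    tsum (comul h) (fun y h3 => tsum (comul y) (fun h1 h2 =>
    S (g1 * h1) * (g2 * h2) * S h3 * S g3)))); try by lin.
  rewrite -(counit_rF (F := fun g => S (g * h)) g); last by lin.
  apply: eq_tsum => g1 x.
  transitivity (tsum (comul x) (fun g2 g3 => S (g1 * h) * (g2 * S g3))).
    rewrite -(lin_tsum_comp (f := fun t => S (g1 * h) * t)); last by lin.
    by rewrite antipode_r scal_mulr mulr1.
  apply: eq_tsum => g2 g3.
  rewrite (comul_assoc (F := fun h1 h2 h3 =>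
    S (g1 * h1) * (g2 * h2) * S h3 * S g3)); try by lin.
  rewrite -(counit_rF (F := fun h => S (g1 * h) * (g2 * S g3)) h); last by lin.
  apply: eq_tsum => h1 y.
  transitivity (tsum (comul y)
     (fun h2 h3 => S (g1 * h1) * g2 * (h2 * S h3) * S g3)).
    rewrite -(lin_tsum_comp (f := fun t => S (g1 * h1) * g2 * t * S g3));
      last by lin.
    by rewrite antipode_r scal_mulr mulr1 scal_mull mulrA.
  by apply: eq_tsum => h2 h3; rewrite !mulrA.
rewrite -(counit_lF (F := fun g => S h * S g) g); last by lin.
apply: eq_tsum => x g3; rewrite tsum_comm.
rewrite -(counit_lF (F := fun h => S h * S g3) h); last by lin.
rewrite (lin_tsum_comp (f := fun t => _ *: t)); last by lin.
apply: eq_tsum => y h3.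
transitivity (tsum (comul (x * y)) (fun u v => S u * v * (S h3 * S g3))).
  rewrite comulM tsum_mul; last by lin.
  by do 2!apply: eq_tsum => ? ?; rewrite !mulrA.
rewrite -(lin_tsum_comp (f := fun t : H => t * (S h3 * S g3))); last by lin.
by rewrite antipode_l counitM scal_mull mul1r scalerA.
Qed.

End HopfTheory.

Section TensorMorphisms.
Variable R : comPzRingType.
Implicit Types A B C : pzAlgType R.

Lemma tmap_lin (U V U' V' : lmodType R) (f : U -> U') (g : V -> V') :
  is_lin f -> is_lin g -> is_lin (tmap f g).
Proof. by move=> lf lg; rewrite /tmap; lin. Qed.

Lemma tmap_pure (U V U' V' : lmodType R) (f : U -> U') (g : V -> V') u v :
  is_lin f -> is_lin g -> tmap f g (u \ot v) = f u \ot g v.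
Proof. by move=> lf lg; rewrite /tmap tsum_pure //; lin. Qed.

Lemma tmapM A B A' B' (f : A -> A') (g : B -> B') :
  is_lin f -> is_lin g -> {morph f : x y / x * y} -> {morph g : x y / x * y} ->
  {morph tmap f g : s t / s * t}.
Proof.
move=> lf lg fM gM s t; have lt := tmap_lin lf lg.
move: s; apply: lin_ext; [lin|lin|move=> a b].
move: t; apply: lin_ext; [lin|lin|move=> a' b'].
by rewrite pureM !tmap_pure // pureM fM gM.
Qed.

Lemma tassoc_lin (U V W : lmodType R) : is_lin (@tassoc R U V W).
Proof. by rewrite /tassoc; lin. Qed.

Lemma tassoc_pure (U V W : lmodType R) (u : U) (v : V) (w : W) :
  tassoc ((u \ot v) \ot w) = u \ot (v \ot w).
Proof. by rewrite /tassoc !tsum_pure //; lin. Qed.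

Lemma tassocM A B C : {morph @tassoc R A B C : s t / s * t}.
Proof.
have la : is_lin (@tassoc R A B C) by apply: tassoc_lin.
move=> s t; move: s; apply: lin_ext; [lin|lin|move=> s c].
move: s; apply: lin_ext; [lin|lin|move=> a b].
move: t; apply: lin_ext; [lin|lin|move=> t c'].
move: t; apply: lin_ext; [lin|lin|move=> a' b'].
by rewrite !pureM !tassoc_pure !pureM.
Qed.

Lemma tassoc1 A B C : @tassoc R A B C 1 = 1.
Proof. exact: tassoc_pure. Qed.

End TensorMorphisms.

Section MkLinear.
Variables (R : comPzRingType) (U V : lmodType R) (f : U -> V) (lf : is_lin f).

Lemma is_lin_linear : linear f.
Proof. by move=> a u v; rewrite (proj1 lf) (proj2 lf). Qed.

Definition mk_linear : {linear U -> V} :=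
  HB.pack f (GRing.isLinear.Build R U V *:%R f is_lin_linear).

End MkLinear.

Record drinfeldTwist (R : comPzRingType) (H : hopfAlg R) := DrinfeldTwist {
  twist : tens H H;
  twist_inv : tens H H;
  twistK : twist * twist_inv = 1;
  twistVK : twist_inv * twist = 1;
  twist_cocycle :
    tassoc ((twist \ot (1 : H)) * tmap comul id twist) =
    ((1 : H) \ot twist) * tmap id comul twist;
  twist_counit_l : tsum twist (fun x y => counit x *: y) = 1;
  twist_counit_r : tsum twist (fun x y => counit y *: x) = 1
}.

Section Twisted.
Variables (R : comPzRingType) (H : hopfAlg R) (T : drinfeldTwist H).
Local Notation J := (twist T).
Local Notation Q := (twist_inv T).
Local Notation S := (@antipode R H).

Definition twisted_comul_fun (h : H) : tens H H := J * comul h * Q.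

Definition twist_unit : H := tsum J (fun x y => x * S y).
Definition twist_unit_inv : H := tsum Q (fun x y => S x * y).

Definition twisted_antipode_fun (h : H) : H :=
  twist_unit * S h * twist_unit_inv.

Lemma twisted_comul_lin : is_lin twisted_comul_fun.
Proof. by rewrite /twisted_comul_fun; lin. Qed.

Lemma twisted_antipode_lin : is_lin twisted_antipode_fun.
Proof. by rewrite /twisted_antipode_fun; lin. Qed.

Definition twisted_comul : {linear H -> tens H H} := mk_linear twisted_comul_lin.
Definition twisted_antipode : {linear H -> H} := mk_linear twisted_antipode_lin.

Lemma twisted_comul1 : twisted_comul 1 = 1.
Proof. by rewrite /= /twisted_comul_fun comul1 mulr1 twistK. Qed.

Lemma twisted_comulM : {morph twisted_comul : g h / g * h}.
Proof.
move=> g h /=; rewrite /twisted_comul_fun comulM !mulrA.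
by rewrite -[_ * Q * J]mulrA twistVK mulr1.
Qed.

Lemma comul_linf : is_lin (@comul R H). Proof. by lin. Qed.
Lemma id_linf : is_lin (@id H). Proof. by lin. Qed.

Lemma tmap_comul_idM (s t : tens H H) :
  tmap comul id (s * t) = tmap comul id s * tmap comul id t.
Proof. by apply: tmapM => //; [exact: comul_linf | exact: comulM]. Qed.

Lemma tmap_id_comulM (s t : tens H H) :
  tmap id comul (s * t) = tmap id comul s * tmap id comul t.
Proof. by apply: tmapM => //; [exact: comul_linf | exact: comulM]. Qed.

Lemma tmap_comul_id1 : tmap comul id (1 : tens H H) = 1.
Proof. by rewrite -pure1 tmap_pure // ?comul1 //; exact: comul_linf. Qed.

Lemma tmap_id_comul1 : tmap id comul (1 : tens H H) = 1.
Proof. by rewrite -pure1 tmap_pure // ?comul1 //; exact: comul_linf. Qed.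

Let J12 : tens (tens H H) H := (J \ot (1 : H)) * tmap comul id J.
Let Q12 : tens (tens H H) H := tmap comul id Q * (Q \ot (1 : H)).
Let J23 : tens H (tens H H) := ((1 : H) \ot J) * tmap id comul J.
Let Q23 : tens H (tens H H) := tmap id comul Q * ((1 : H) \ot Q).

Lemma J12K : J12 * Q12 = 1.
Proof.
rewrite /J12 /Q12 mulrA -[_ * tmap comul id Q]mulrA -tmap_comul_idM twistK.
by rewrite tmap_comul_id1 mulr1 pureM twistK mulr1.
Qed.

Lemma Q23K : Q23 * J23 = 1.
Proof.
rewrite /J23 /Q23 mulrA -[_ * ((1 : H) \ot J)]mulrA pureM twistVK mulr1.
by rewrite pure1 mulr1 -tmap_id_comulM twistVK tmap_id_comul1.
Qed.

Lemma tassocQ : tassoc Q12 = Q23.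
Proof.
have e : J23 * tassoc Q12 = 1.
  by rewrite /J23 -twist_cocycle -/J12 -(tassocM J12 Q12) J12K tassoc1.
by rewrite -[LHS]mul1r -Q23K -mulrA e mulr1.
Qed.

Lemma twisted_comulA (h : H) :
  tassoc (tmap twisted_comul id (twisted_comul h)) =
  tmap id twisted_comul (twisted_comul h).
Proof.
have lc := comul_linf; have li := id_linf; have lt := twisted_comul_lin.
have lci : is_lin (tmap (@comul R H) (@id H)) by apply: tmap_lin.
have lic : is_lin (tmap (@id H) (@comul R H)) by apply: tmap_lin.
have lti : is_lin (tmap twisted_comul (@id H)) by apply: tmap_lin.
have lit : is_lin (tmap (@id H) twisted_comul) by apply: tmap_lin.
have e1 : forall t, tmap twisted_comul id t =
    (J \ot (1 : H)) * tmap comul id t * (Q \ot (1 : H)).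
  apply: lin_ext; [lin|lin|move=> x y].
  by rewrite !tmap_pure // !pureM mul1r mulr1.
have e2 : forall t, tmap id twisted_comul t =
    ((1 : H) \ot J) * tmap id comul t * ((1 : H) \ot Q).
  apply: lin_ext; [lin|lin|move=> x y].
  by rewrite !tmap_pure // !pureM mul1r mulr1.
rewrite e1 e2 /= /twisted_comul_fun !tmap_comul_idM !tmap_id_comulM.
transitivity (tassoc (J12 * tmap comul id (comul h) * Q12)).
  by congr tassoc; rewrite /J12 /Q12 !mulrA.
rewrite (tassocM (J12 * tmap comul id (comul h)) Q12) tassocQ.
rewrite (tassocM J12 (tmap comul id (comul h))) comulA /J12 twist_cocycle /Q23.
by rewrite !mulrA.
Qed.

Lemma tsum_counit_lM (s t : tens H H) :
  tsum (s * t) (fun x y => counit x *: y) =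
  tsum s (fun x y => counit x *: y) * tsum t (fun x y => counit x *: y).
Proof.
move: s; apply: lin_ext; [lin|lin|move=> a b].
move: t; apply: lin_ext; [lin|lin|move=> a' b'].
rewrite pureM !tsum_pure; try by lin.
by rewrite counitM scal_mull scal_mulr scalerA.
Qed.

Lemma tsum_counit_rM (s t : tens H H) :
  tsum (s * t) (fun x y => counit y *: x) =
  tsum s (fun x y => counit y *: x) * tsum t (fun x y => counit y *: x).
Proof.
move: s; apply: lin_ext; [lin|lin|move=> a b].
move: t; apply: lin_ext; [lin|lin|move=> a' b'].
rewrite pureM !tsum_pure; try by lin.
by rewrite counitM scal_mull scal_mulr scalerA.
Qed.

Lemma twist_inv_counit_l : tsum Q (fun x y => counit x *: y) = 1.
Proof.
rewrite -[LHS]mul1r -{1}(twist_counit_l T) -tsum_counit_lM twistK -pure1.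
by rewrite tsum_pure ?counit1 ?scale1r //; lin.
Qed.

Lemma twist_inv_counit_r : tsum Q (fun x y => counit y *: x) = 1.
Proof.
rewrite -[LHS]mul1r -{1}(twist_counit_r T) -tsum_counit_rM twistK -pure1.
by rewrite tsum_pure ?counit1 ?scale1r //; lin.
Qed.

Lemma twisted_counit_l (h : H) :
  tsum (twisted_comul h) (fun h1 h2 => counit h1 *: h2) = h.
Proof.
rewrite /= /twisted_comul_fun !tsum_counit_lM twist_counit_l counit_l.
by rewrite twist_inv_counit_l mul1r mulr1.
Qed.

Lemma twisted_counit_r (h : H) :
  tsum (twisted_comul h) (fun h1 h2 => counit h2 *: h1) = h.
Proof.
rewrite /= /twisted_comul_fun !tsum_counit_rM twist_counit_r counit_r.
by rewrite twist_inv_counit_r mul1r mulr1.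
Qed.

(* Apply x (x) y (x) z |-> x S(y) z to both sides of                          *)
(* (1 (x) J^-1)(J (x) 1) = (1 (x) Delta)(J) (Delta (x) 1)(J^-1).              *)
Lemma twist_unitK : twist_unit * twist_unit_inv = 1.
Proof.
have lc := comul_linf; have li := id_linf.
have lci : is_lin (tmap (@comul R H) (@id H)) by apply: tmap_lin.
have lic : is_lin (tmap (@id H) (@comul R H)) by apply: tmap_lin.
have la : is_lin (@tassoc R H H H) by apply: tassoc_lin.
pose L (t : tens H (tens H H)) :=
  tsum t (fun x s => tsum s (fun y z => x * S y * z)).
have lL : is_lin L by rewrite /L; lin.
have Lp x y z : L (x \ot (y \ot z)) = x * S y * z.
  by rewrite /L tsum_pure ?tsum_pure //; lin.
have e : ((1 : H) \ot Q) * tassoc (J \ot (1 : H)) =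
    tmap id comul J * tassoc (tmap comul id Q).
  have eJ : tassoc (J \ot (1 : H)) =
      tassoc J12 * tassoc (tmap comul id Q).
    rewrite -(tassocM J12 (tmap comul id Q)) /J12 -mulrA -tmap_comul_idM twistK tmap_comul_id1.
    by rewrite mulr1.
  rewrite eJ /J12 twist_cocycle !mulrA pureM twistVK mulr1.
  by rewrite pure1 mul1r.
transitivity (L (((1 : H) \ot Q) * tassoc (J \ot (1 : H)))).
  rewrite /twist_unit /twist_unit_inv.
  move: J; apply: lin_ext; [lin|lin|move=> a b].
  move: Q; apply: lin_ext; [lin|lin|move=> c d].
  rewrite tassoc_pure pureM pureM mul1r mulr1 Lp antipodeM.
  by rewrite !tsum_pure; try lin; rewrite !mulrA.
rewrite e.
have : forall s t : tens H H,
    L (tmap id comul s * tassoc (tmap comul id t)) =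
    tsum s (fun x y => counit y *: x) * tsum t (fun x y => counit x *: y).
  move=> s t; move: s; apply: lin_ext; [lin|lin|move=> a b].
  move: t; apply: lin_ext; [lin|lin|move=> c d].
  rewrite !tmap_pure // !tsum_pure; try by lin.
  transitivity (tsum (comul b) (fun b1 b2 => tsum (comul c) (fun c1 c2 =>
      a * (c1 * S c2) * (S b1 * b2) * d))).
    move: (comul b); apply: lin_ext; [lin|lin|move=> b1 b2].
    move: (comul c); apply: lin_ext; [lin|lin|move=> c1 c2].
    rewrite tassoc_pure !pureM Lp antipodeM !tsum_pure; try by lin.
    by rewrite !mulrA.
  rewrite tsum_comm.
  transitivity (tsum (comul c) (fun c1 c2 => counit b *: (a * (c1 * S c2) * d))).
    apply: eq_tsum => c1 c2.
    rewrite -(lin_tsum_comp (f := fun t : H => a * (c1 * S c2) * t * d));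
      last by lin.
    by rewrite antipode_l scal_mulr mulr1 scal_mull.
  rewrite -(lin_tsum_comp (f := fun t : H => counit b *: (a * t * d)));
    last by lin.
  rewrite antipode_r !(scal_mulr, scal_mull) mulr1 !scalerA.
  by rewrite [counit b * _]mulrC.
by move->; rewrite twist_counit_r twist_inv_counit_l mulr1.
Qed.

Lemma antipode_sandwich_l (s t : tens H H) :
  tsum s (fun x y => S x * tsum t (fun x y => S x * y) * y) =
  tsum (t * s) (fun x y => S x * y).
Proof.
move: s; apply: lin_ext; [lin|lin|move=> a b].
move: t; apply: lin_ext; [lin|lin|move=> c d].
rewrite pureM !tsum_pure; try by lin.
by rewrite antipodeM !mulrA.
Qed.

Lemma antipode_sandwich_r (s t : tens H H) :
  tsum s (fun x y => x * tsum t (fun x y => x * S y) * S y) =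
  tsum (s * t) (fun x y => x * S y).
Proof.
move: s; apply: lin_ext; [lin|lin|move=> a b].
move: t; apply: lin_ext; [lin|lin|move=> c d].
rewrite pureM !tsum_pure; try by lin.
by rewrite antipodeM !mulrA.
Qed.

Lemma twisted_antipode_l (h : H) :
  tsum (twisted_comul h) (fun h1 h2 => twisted_antipode h1 * h2) =
  counit h *: (1 : H).
Proof.
rewrite /= /twisted_comul_fun /twisted_antipode_fun.
have e (s t u : tens H H) :
    tsum (s * t * u)
      (fun x y => twist_unit * S x * twist_unit_inv * y) =
    twist_unit * tsum u (fun x y => S x * tsum t (fun x y =>
      S x * tsum s (fun x y => S x * twist_unit_inv * y) * y) * y).
  move: s; apply: lin_ext; [lin|lin|move=> a b].
  move: t; apply: lin_ext; [lin|lin|move=> a' b'].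
  move: u; apply: lin_ext; [lin|lin|move=> a2 b2].
  rewrite !pureM !tsum_pure; try by lin.
  by rewrite !antipodeM !mulrA.
have eJ : tsum J (fun x y => S x * twist_unit_inv * y) = 1.
  rewrite antipode_sandwich_l twistVK -pure1 tsum_pure; last by lin.
  by rewrite antipode1 mulr1.
rewrite e eJ; transitivity (counit h *: (twist_unit * twist_unit_inv)).
  rewrite -scal_mulr; congr (_ * _).
  rewrite (lin_tsum_comp (f := fun t : H => counit h *: t)); last by lin.
  apply: eq_tsum => x y; rewrite -scal_mulr -[counit h *: y]mul1r.
  rewrite scal_mulr -scal_mull -antipode_l -mulrA; congr (_ * (_ * _)).
  by apply: eq_tsum => h1 h2; rewrite mulr1.
by rewrite twist_unitK.
Qed.

Lemma twisted_antipode_r (h : H) :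
  tsum (twisted_comul h) (fun h1 h2 => h1 * twisted_antipode h2) =
  counit h *: (1 : H).
Proof.
rewrite /= /twisted_comul_fun /twisted_antipode_fun.
have e (s t u : tens H H) :
    tsum (s * t * u)
      (fun x y => x * (twist_unit * S y * twist_unit_inv)) =
    tsum s (fun x y => x * tsum t (fun x y =>
      x * tsum u (fun x y => x * twist_unit * S y) * S y) * S y)
    * twist_unit_inv.
  move: s; apply: lin_ext; [lin|lin|move=> a b].
  move: t; apply: lin_ext; [lin|lin|move=> a' b'].
  move: u; apply: lin_ext; [lin|lin|move=> a2 b2].
  rewrite !pureM !tsum_pure; try by lin.
  by rewrite !antipodeM !mulrA.
have eQ : tsum Q (fun x y => x * twist_unit * S y) = 1.
  rewrite antipode_sandwich_r twistVK -pure1 tsum_pure; last by lin.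
  by rewrite antipode1 mulr1.
rewrite e eQ; transitivity (counit h *: (twist_unit * twist_unit_inv)).
  rewrite -scal_mull; congr (_ * _).
  rewrite (lin_tsum_comp (f := fun t : H => counit h *: t)); last by lin.
  apply: eq_tsum => x y; rewrite -scal_mull -[counit h *: x]mulr1.
  rewrite scal_mull -scal_mulr -antipode_r; congr (_ * _ * _).
  by apply: eq_tsum => h1 h2; rewrite mulr1.
by rewrite twist_unitK.
Qed.

Definition twisted_hopf : hopfAlg R := {|
  hopf_alg := hopf_alg H;
  comul := twisted_comul;
  counit := @counit R H;
  antipode := twisted_antipode;
  comul1 := twisted_comul1;
  comulM := twisted_comulM;
  counit1 := @counit1 R H;
  counitM := @counitM R H;
  comulA := twisted_comulA;
  counit_l := twisted_counit_l;
  counit_r := twisted_counit_r;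
  antipode_l := twisted_antipode_l;
  antipode_r := twisted_antipode_r
|}.

End Twisted.

Section Semiprime.
Variable S : pzRingType.

Definition is_ideal (I : S -> Prop) : Prop :=
  [/\ I 0,
      forall x y, I x -> I y -> I (x + y),
      forall a x, I x -> I (a * x)
    & forall a x, I x -> I (x * a)].

(* I ^ n is additively generated by the n-fold products of elements of I.     *)
Definition is_nilpotent (I : S -> Prop) : Prop :=
  exists n : nat, forall x : 'I_n -> S,
    (forall i, I (x i)) -> \prod_(i < n) x i = 0.

Definition semiprime : Prop := forall I : S -> Prop,
  is_ideal I -> is_nilpotent I -> forall x, I x -> x = 0.

End Semiprime.

Record moduleAlg (R : comPzRingType) (H : hopfAlg R) := ModuleAlg {
  modalg :> pzAlgType R;
  act : H -> modalg -> modalg;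
  act_bilin : is_bilin act;
  act1 : forall a, act 1 a = a;
  actM : forall g h a, act (g * h) a = act g (act h a);
  act_one : forall h, act h 1 = counit h *: (1 : modalg);
  act_mul : forall h a b,
    act h (a * b) = tsum (comul h) (fun h1 h2 => act h1 a * act h2 b)
}.
Arguments act {R H m} : rename.

Section ModuleAlgebra.
Variables (R : comPzRingType) (H : hopfAlg R) (A : moduleAlg H).

Definition is_stable (I : A -> Prop) : Prop :=
  forall (h : H) a, I a -> I (act h a).

Definition H_semiprime : Prop := forall I : A -> Prop,
  is_ideal I -> is_stable I -> is_nilpotent I -> forall x, I x -> x = 0.

(* The multiplication of A # H differs from that of the tensor product        *)
(* algebra, hence a separate name for its carrier.                            *)
Definition smash : Type := tens A H.
HB.instance Definition _ := GRing.Lmodule.on smash.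

Definition smash_one : smash := (1 : A) \ot (1 : H).
Definition smash_mul (s t : smash) : smash :=
  tsum s (fun a h => tsum t (fun b g =>
    tsum (comul h) (fun h1 h2 => (a * act h1 b) \ot (h2 * g)))).

Lemma act_linl (X : lmodType R) (a : A) (f : X -> H) :
  is_lin f -> is_lin (fun x => act (f x) a).
Proof. exact: (lin_comp (bilin_l a (act_bilin A))). Qed.

Lemma act_linr (X : lmodType R) (h : H) (f : X -> A) :
  is_lin f -> is_lin (fun x => act h (f x)).
Proof. exact: (lin_comp (bilin_r h (act_bilin A))). Qed.

Ltac lin_extra ::= first [apply: act_linl | apply: act_linr].

Lemma smash_mul_bilin : @is_bilin R (tens A H) (tens A H) (tens A H) smash_mul.
Proof. by rewrite /smash_mul; lin. Qed.

Lemma smash_mulE a h b g :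
  smash_mul (a \ot h) (b \ot g) =
  tsum (comul h) (fun h1 h2 => (a * act h1 b) \ot (h2 * g)).
Proof. by rewrite /smash_mul !tsum_pure //; lin. Qed.

Lemma smash_mulA : associative smash_mul.
Proof.
have bm := smash_mul_bilin; rewrite /smash in bm *.
move=> s t u; move: s; apply: lin_ext; [lin|lin|move=> a h].
move: t; apply: lin_ext; [lin|lin|move=> b g].
move: u; apply: lin_ext; [lin|lin|move=> c k].
transitivity (tsum (comul h) (fun x h3 => tsum (comul x) (fun h1 h2 =>
  tsum (comul g) (fun g1 g2 =>
    (a * (act h1 b * act h2 (act g1 c))) \ot (h3 * (g2 * k)))))).
  rewrite smash_mulE (lin_tsum_comp (f := smash_mul (a \ot h))); last by lin.
  under eq_tsum => g1 g2.
    rewrite smash_mulE.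
    under eq_tsum => x h3.
      rewrite act_mul (lin_tsum_comp (f := fun z : A => (a * z) \ot _));
        last by lin.
      over.
    over.
  rewrite tsum_comm; apply: eq_tsum => x h3.
  by rewrite tsum_comm.
rewrite comul_assoc; try by lin.
rewrite smash_mulE (lin_tsum_comp (f := fun z => smash_mul z (c \ot k)));
  last by lin.
apply: eq_tsum => h1 x; rewrite smash_mulE comulM tsum_mul; last by lin.
do 2!apply: eq_tsum => ? ?.
by rewrite actM !mulrA.
Qed.

Lemma smash_mul1l : left_id smash_one smash_mul.
Proof.
have bm := smash_mul_bilin; rewrite /smash in bm *.
apply: lin_ext; [lin|lin|move=> a h].
rewrite smash_mulE comul1 -pure1 tsum_pure; last by lin.
by rewrite act1 !mul1r.
Qed.

Lemma smash_mul1r : right_id smash_one smash_mul.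
Proof.
have bm := smash_mul_bilin; rewrite /smash in bm *.
apply: lin_ext; [lin|lin|move=> a h].
rewrite smash_mulE -[in RHS](counit_l h).
rewrite (lin_tsum_comp (f := fun z : H => a \ot z)); last by lin.
apply: eq_tsum => h1 h2.
rewrite act_one scal_mulr !mulr1.
by rewrite (proj2 (bilin_l h2 (pure_bilin A H))) (proj2 (bilin_r a (pure_bilin A H))).
Qed.

Lemma smash_mulDl : left_distributive smash_mul +%R.
Proof. by move=> s t u; rewrite (proj1 (bilin_l u smash_mul_bilin)). Qed.

Lemma smash_mulDr : right_distributive smash_mul +%R.
Proof. by move=> u s t; rewrite (proj1 (bilin_r u smash_mul_bilin)). Qed.

Lemma smash_scalAl (a : R) s t : a *: smash_mul s t = smash_mul (a *: s) t.
Proof. by rewrite (proj2 (bilin_l t smash_mul_bilin)). Qed.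

Lemma smash_scalAr (a : R) s t : a *: smash_mul s t = smash_mul s (a *: t).
Proof. by rewrite (proj2 (bilin_r s smash_mul_bilin)). Qed.

HB.instance Definition _ := isPzAlgebra.Build R smash
  smash_mulA smash_mul1l smash_mul1r smash_mulDl smash_mulDr
  smash_scalAl smash_scalAr.
HB.instance Definition _ :=
  GRing.PzRing.copy smash (PzAlgebra.sort (smash : pzAlgType R)).

End ModuleAlgebra.

Definition strongly_semisimple (R : comPzRingType) (H : hopfAlg R) : Prop :=
  forall A : moduleAlg H, H_semiprime A -> semiprime (smash A).

(* Main.v *)
(** Let [A] be an [H^J]-module algebra.  Since [Delta^J(h) J = J Delta(h)], the
    product [a * b := sum (J^1 a)(J^2 b)] turns the [H]-module [A] into an
    [H]-module algebra [A_J], associativity being the cocycle identity.  As the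
    product of [A] is [sum (Q^1 a) * (Q^2 b)] with [Q = J^-1], every [H]-stable
    (nilpotent) ideal of [A_J] is also one of [A].  Finally,
    [a # h |-> sum J^1 a # J^2 h] is a ring isomorphism from [A_J # H] to
    [A # H^J]. *)
Require Import Defs.
From HB Require Import structures.
From mathcomp Require Import all_boot all_algebra.

Set Implicit Arguments.
Unset Strict Implicit.
Unset Printing Implicit Defensive.

Import GRing.Theory.
Local Open Scope ring_scope.

(** * Ring isomorphisms and the Sweedler form of the cocycle identity *)

(** A nilpotent ideal of [T] is pulled back along [f]; the exponent is unchanged because [f] is
    injective. *)
Lemma semiprime_bij (S T : pzRingType) (f : S -> T) (g : T -> S) :
  {morph f : x y / x + y} -> {morph f : x y / x * y} -> f 0 = 0 -> f 1 = 1 ->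
  cancel f g -> cancel g f -> semiprime S -> semiprime T.
Proof.
move=> fD fM f0 f1 fK gK sS I [I0 ID Il Ir] [n In] x Ix.
suff gx0 : g x = 0 by rewrite -(gK x) gx0.
apply: (sS (fun s => I (f s))); last by rewrite gK.
- split; first by rewrite f0.
  + by move=> s t Is It; rewrite fD; apply: ID.
  + by move=> s t It; rewrite fM; apply: Il.
  + by move=> s t It; rewrite fM; apply: Ir.
- exists n => s Is; apply: (can_inj fK); rewrite f0.
  by rewrite (big_morph f fM f1); apply: In.
Qed.

(** Obtained by applying the linear map u (x) v (x) w |-> [F u v w] to both sides of
    [twist_cocycle]. *)
Lemma cocycle_tsum (R : comPzRingType) (H : hopfAlg R) (T : drinfeldTwist H)
    (W : lmodType R) (F : H -> H -> H -> W) :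
  (forall v w, is_lin (fun u => F u v w)) ->
  (forall u w, is_lin (fun v => F u v w)) ->
  (forall u v, is_lin (fun w => F u v w)) ->
  tsum (twist T) (fun x w =>
    tsum (twist T * comul x) (fun u v => F u v w)) =
  tsum (twist T) (fun u x =>
    tsum (twist T * comul x) (fun v w => F u v w)).
Proof.
move=> F1 F2 F3.
have lc := comul_linf H; have li := id_linf H.
have lci : is_lin (tmap (@comul R H) (@id H)) by apply: tmap_lin.
have lic : is_lin (tmap (@id H) (@comul R H)) by apply: tmap_lin.
have la : is_lin (@tassoc R H H H) by apply: tassoc_lin.
pose L (t : tens H (tens H H)) := tsum t (fun u s => tsum s (F u)).
have bF u : is_bilin (F u) by lin.
have lL : is_lin L by rewrite /L; lin.
(* Only the twist under the coproduct becomes a variable [t], so that it can be reduced to pure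
   tensors while the other one stays fixed. *)
have left_leg t : L (tassoc ((twist T \ot (1 : H)) * tmap comul id t)) =
    tsum t (fun x w => tsum (twist T * comul x) (fun u v => F u v w)).
  move: t; apply: lin_ext; [lin|lin|move=> x w].
  rewrite tmap_pure // pureM mul1r tsum_pure; last by lin.
  move: (twist T * comul x); apply: lin_ext; [lin|lin|move=> u v].
  by rewrite tassoc_pure /L !tsum_pure //; lin.
have right_leg t : L (((1 : H) \ot twist T) * tmap id comul t) =
    tsum t (fun u x => tsum (twist T * comul x) (fun v w => F u v w)).
  move: t; apply: lin_ext; [lin|lin|move=> u x].
  rewrite tmap_pure // pureM mul1r tsum_pure; last by lin.
  by rewrite /L tsum_pure //; lin.
by rewrite -left_leg -right_leg twist_cocycle.
Qed.

(** * The twisted product on a module algebra *)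

Section TwistedModuleAlgebra.
Variables (R : comPzRingType) (H : hopfAlg R) (T : drinfeldTwist H).
Variable A : moduleAlg (twisted_hopf T).
Local Notation J := (twist T).
Local Notation Q := (twist_inv T).

(* [act] at the type [H] rather than at the convertible [twisted_hopf T]. *)
Definition actH : H -> A -> A := @act R (twisted_hopf T) A.

Lemma actH_bilin : is_bilin actH. Proof. exact: (act_bilin A). Qed.

Lemma actH1 a : actH 1 a = a. Proof. exact: (act1 (m := A)). Qed.

Lemma actHM (g h : H) a : actH (g * h) a = actH g (actH h a).
Proof. exact: (actM (m := A) g h a). Qed.

Lemma actH_one (h : H) : actH h 1 = counit h *: (1 : A).
Proof. exact: (act_one A h). Qed.

(** The multiplication map of [A] after the action of [t] on a (x) b. Identities in H (x) H thus
    become identities between products. *)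
Definition act2 (t : tens H H) (a b : A) : A :=
  tsum t (fun x y => actH x a * actH y b).

Lemma actH_mul (h : H) a b : actH h (a * b) = act2 (J * comul h * Q) a b.
Proof. exact: (act_mul (m := A) h a b). Qed.

Lemma act2M s t a b :
  act2 (s * t) a b = tsum t (fun x y => act2 s (actH x a) (actH y b)).
Proof.
have ba := actH_bilin.
rewrite /act2 tsum_mul; last by lin.
by rewrite tsum_comm; do 2!apply: eq_tsum => ? ?; rewrite !actHM.
Qed.

Lemma act2_1 a b : act2 1 a b = a * b.
Proof.
have ba := actH_bilin.
by rewrite /act2 -pure1 tsum_pure ?actH1 //; lin.
Qed.

Lemma act2_linl t b : is_lin (act2 t ^~ b).
Proof. by have ba := actH_bilin; rewrite /act2; lin. Qed.

Lemma act2_linr t a : is_lin (act2 t a).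
Proof. by have ba := actH_bilin; rewrite /act2; lin. Qed.

(** A second name for the carrier, so that the twisted product can be a ring structure beside the
    one of [A]. *)
Definition twalg : Type := A.
HB.instance Definition _ := GRing.Lmodule.on twalg.

Definition twalg_mul (a b : twalg) : twalg := act2 J a b.

Lemma twalg_mul_bilin : @is_bilin R A A A twalg_mul.
Proof. by split=> u; [exact: act2_linl | exact: act2_linr]. Qed.

(** The twisted coproduct ends in [Q], which cancels the [J] of the twisted product. *)
Lemma actH_twalg_mul_act2 (h : H) a b :
  actH h (twalg_mul a b) = act2 (J * comul h) a b.
Proof.
have ba := actH_bilin.
rewrite /twalg_mul {1}/act2 (lin_tsum_comp (f := actH h)); last by lin.
transitivity (act2 (J * comul h * Q * J) a b).
  by rewrite act2M; apply: eq_tsum => x y; rewrite actH_mul.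
by rewrite -mulrA twistVK mulr1.
Qed.

Lemma actH_twalg_mul (h : H) a b :
  actH h (twalg_mul a b) =
  tsum (comul h) (fun h1 h2 => twalg_mul (actH h1 a) (actH h2 b)).
Proof. by rewrite actH_twalg_mul_act2 act2M. Qed.

Lemma mul_twalg (a b : A) :
  a * b = tsum Q (fun x y => twalg_mul (actH x a) (actH y b)).
Proof. by rewrite -act2_1 -(twistK T) act2M. Qed.

(** The two bracketings sum [actH u a * actH v b * actH w c] over (1 (x) J)(1 (x) Delta)(J) and (J
    (x) 1)(Delta (x) 1)(J) respectively. *)
Lemma twalg_mulA : associative twalg_mul.
Proof.
have ba := actH_bilin; move=> a b c.
transitivity (tsum J (fun u x => tsum (J * comul x)
    (fun v w => actH u a * actH v b * actH w c))).
  rewrite {1}/twalg_mul {1}/act2; apply: eq_tsum => u x.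
  rewrite actH_twalg_mul_act2 /act2.
  rewrite (lin_tsum_comp (f := fun z : A => actH u a * z)); last by lin.
  by apply: eq_tsum => v w; rewrite mulrA.
rewrite -cocycle_tsum; try by lin.
rewrite [in RHS]/twalg_mul {1}/act2; apply: eq_tsum => x w.
rewrite actH_twalg_mul_act2 /act2.
by rewrite (lin_tsum_comp (f := fun z : A => z * actH w c)); last by lin.
Qed.

(** [H] acts on 1 through the counit, which collapses the first leg of [J]. *)
Lemma twalg_mul1l : left_id (1 : A) twalg_mul.
Proof.
have ba := actH_bilin; move=> a; rewrite /twalg_mul /act2.
rewrite -[RHS]actH1 -(twist_counit_l T).
rewrite (lin_tsum_comp (f := actH^~ a)); last by lin.
apply: eq_tsum => x y.
by rewrite actH_one scal_mull mul1r (proj2 (bilin_l a ba)).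
Qed.

Lemma twalg_mul1r : right_id (1 : A) twalg_mul.
Proof.
have ba := actH_bilin; move=> a; rewrite /twalg_mul /act2.
rewrite -[RHS]actH1 -(twist_counit_r T).
rewrite (lin_tsum_comp (f := actH^~ a)); last by lin.
apply: eq_tsum => x y.
by rewrite actH_one scal_mulr mulr1 (proj2 (bilin_l a ba)).
Qed.

Lemma twalg_mulDl : left_distributive twalg_mul +%R.
Proof. by move=> a b c; rewrite (proj1 (bilin_l c twalg_mul_bilin)). Qed.

Lemma twalg_mulDr : right_distributive twalg_mul +%R.
Proof. by move=> c a b; rewrite (proj1 (bilin_r c twalg_mul_bilin)). Qed.

Lemma twalg_scalAl (k : R) a b : k *: twalg_mul a b = twalg_mul (k *: a) b.
Proof. by rewrite (proj2 (bilin_l b twalg_mul_bilin)). Qed.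

Lemma twalg_scalAr (k : R) a b : k *: twalg_mul a b = twalg_mul a (k *: b).
Proof. by rewrite (proj2 (bilin_r a twalg_mul_bilin)). Qed.

HB.instance Definition _ := isPzAlgebra.Build R twalg
  twalg_mulA twalg_mul1l twalg_mul1r twalg_mulDl twalg_mulDr
  twalg_scalAl twalg_scalAr.
HB.instance Definition _ :=
  GRing.PzRing.copy twalg (PzAlgebra.sort (twalg : pzAlgType R)).

(** Ring notation for [actH_twalg_mul], to rewrite under the iterated products below. *)
Lemma actH_mulr (h : H) (a b : twalg) :
  actH h (a * b : twalg) =
  tsum (comul h) (fun h1 h2 =>
    (actH h1 a : twalg) * (actH h2 b : twalg) : twalg).
Proof. exact: actH_twalg_mul. Qed.

Definition twmod : moduleAlg H :=
  @ModuleAlg R H twalg actH actH_bilin actH1 actHM actH_one actH_twalg_mul.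

(** * Stable nilpotent ideals under untwisting *)

Section Ideals.
Variable I : twmod -> Prop.
Hypotheses (idI : is_ideal I) (stI : is_stable I).

Lemma ideal_tsum (X : lmodType R) (t : tens H X) (F : H -> X -> A) :
  (forall x y, I (F x y)) -> I (tsum t F).
Proof. by case: idI => I0 ID _ _ IF; apply: (big_ind I). Qed.

(** In each summand given by [mul_twalg] the factor from [I] is moved by an element of [H], hence
    stays in [I] by stability. *)
Lemma twalg_ideal : @is_ideal A I.
Proof.
case: (idI) => I0 ID Il Ir; split=> // a x Ix; rewrite mul_twalg.
  by apply: ideal_tsum => u v; apply: Il; apply: (stI v).
by apply: ideal_tsum => u v; apply: Ir; apply: (stI u).
Qed.

(* The right ideal [I^n A] of [twalg]; unlike the additive span of the [n]-fold
   products it is stable for [n = 0] too. *)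
Inductive twpow (n : nat) : twalg -> Prop :=
| Twpow0 : twpow n 0
| TwpowD a b : twpow n a -> twpow n b -> twpow n (a + b)
| TwpowP (x : 'I_n -> twalg) c : (forall i, I (x i)) ->
    twpow n (\prod_(i < n) x i * c).

Lemma twpow_tsum n (U V : lmodType R) (t : tens U V) (F : U -> V -> twalg) :
  (forall x y, twpow n (F x y)) -> twpow n (tsum t F).
Proof.
by move=> HF; apply: (big_ind (twpow n)) => //; [exact: Twpow0 | exact: TwpowD].
Qed.

(** The free factor [c] after the empty product reaches every element; this starts the inductions on
    [n] below. *)
Lemma twpow0T b : twpow 0 b.
Proof.
have -> : b = \prod_(i < 0) (0 : twalg) * b by rewrite big_ord0 mul1r.
by apply: TwpowP; case.
Qed.

Lemma twpow_mul n (a b : twalg) : I a -> twpow n b -> twpow n.+1 (a * b).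
Proof.
move=> Ia; elim=> {b} [|b c _ IHb _ IHc|x c Ix].
- by rewrite mulr0; apply: Twpow0.
- by rewrite mulrDr; apply: TwpowD.
(* The family [x] with [a] put in front, at index [ord0]. *)
pose y i := oapp x a (unlift ord0 i).
have -> : a * (\prod_(i < n) x i * c) = \prod_(i < n.+1) y i * c.
  rewrite big_ord_recl /y unlift_none mulrA; congr (_ * _ * _).
  by apply: eq_bigr => i _; rewrite liftK.
by apply: TwpowP => i; rewrite /y; case: unlift.
Qed.

Lemma twpow_stable n (h : H) b : twpow n b -> twpow n (actH h b).
Proof.
have ba := actH_bilin.
elim=> {b} [|b c _ IHb _ IHc|x c Ix].
- by rewrite (lin0 (bilin_r h ba)); apply: Twpow0.
- by rewrite (proj1 (bilin_r h ba)); apply: TwpowD.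
(* [h] must vary: the second leg of its coproduct acts on the remaining factors. *)
elim: n h x Ix => [|n IHn] h x Ix.
  exact: twpow0T.
rewrite big_ord_recl -mulrA actH_mulr.
apply: twpow_tsum => u v; apply: twpow_mul; first exact: stI.
exact: IHn.
Qed.

(** The product here is that of [A]. Splitting off its first factor with [mul_twalg] lets [H] act on
    the rest, which [twpow_stable] absorbs. *)
Lemma twpow_prod n (x : 'I_n -> A) :
  (forall i, I (x i)) -> twpow n (\prod_(i < n) x i).
Proof.
elim: n x => [|n IHn] x Ix.
  exact: twpow0T.
rewrite big_ord_recl mul_twalg; apply: twpow_tsum => u v.
apply: twpow_mul; first exact: stI.
by apply: twpow_stable; apply: IHn.
Qed.

Lemma twalg_nilpotent : is_nilpotent I -> @is_nilpotent A I.
Proof.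
case=> n In; exists n => x Ix.
(* The generators of [twpow n] begin with an [n]-fold twisted product, which vanishes; so the same
   exponent serves. *)
elim: (twpow_prod Ix) => [|a b _ -> _ ->|y c Iy] //; first by rewrite addr0.
by rewrite In // mul0r.
Qed.

End Ideals.

Lemma twmod_semiprime : H_semiprime A -> H_semiprime twmod.
Proof.
move=> sA I idI stI nI; apply: sA => //; first exact: twalg_ideal.
exact: twalg_nilpotent.
Qed.

(** * The isomorphism of smash products *)

(** The module A (x) H over H (x) H, with left multiplication on the second factor. Acting by [J] is
    therefore inverted by acting by [Q]. *)
Definition tens_act (t : tens H H) (s : tens A H) : tens A H :=
  tsum t (fun x y => tsum s (fun a h => actH x a \ot (y * h))).

Lemma tens_act_bilin : is_bilin tens_act.
Proof. by have ba := actH_bilin; rewrite /tens_act; lin. Qed.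

Lemma tens_act_pure t a (h : H) :
  tens_act t (a \ot h) = tsum t (fun x y => actH x a \ot (y * h)).
Proof.
have ba := actH_bilin.
by apply: eq_tsum => x y; rewrite tsum_pure //; lin.
Qed.

Lemma tens_act1 s : tens_act 1 s = s.
Proof.
have ba := actH_bilin; have bt := tens_act_bilin.
move: s; apply: lin_ext; [lin|lin|move=> a h].
by rewrite tens_act_pure -pure1 tsum_pure ?actH1 ?mul1r //; lin.
Qed.

Lemma tens_actM t u s : tens_act (t * u) s = tens_act t (tens_act u s).
Proof.
have ba := actH_bilin; have bt := tens_act_bilin.
move: s; apply: lin_ext; [lin|lin|move=> a h].
rewrite !tens_act_pure tsum_mul; last by lin.
rewrite tsum_comm (lin_tsum_comp (f := tens_act t)); last by lin.
apply: eq_tsum => x y; rewrite tens_act_pure.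
by apply: eq_tsum => x' y'; rewrite actHM mulrA.
Qed.

Definition smash_twist (s : smash twmod) : smash A := tens_act J s.
Definition smash_untwist (s : smash A) : smash twmod := tens_act Q s.

Lemma smash_twistK : cancel smash_twist smash_untwist.
Proof.
by move=> s; rewrite /smash_untwist /smash_twist -tens_actM twistVK tens_act1.
Qed.

Lemma smash_untwistK : cancel smash_untwist smash_twist.
Proof.
by move=> s; rewrite /smash_untwist /smash_twist -tens_actM twistK tens_act1.
Qed.

(** On pure tensors the two sides expand over the two sides of the cocycle identity, each combined
    with the coproduct of [h]. *)
Lemma smash_twistM : {morph smash_twist : s t / s * t}.
Proof.
have ba := actH_bilin; have bt := tens_act_bilin.
(* Both products are read on the common module [tens A H], where [lin_ext] applies. *)
pose mulH : tens A H -> tens A H -> tens A H := @smash_mul R H twmod.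
pose mulHJ : tens A H -> tens A H -> tens A H :=
  @smash_mul R (twisted_hopf T) A.
have bH : is_bilin mulH := smash_mul_bilin twmod.
have bHJ : is_bilin mulHJ := smash_mul_bilin A.
have mulHE a h b g : mulH (a \ot h) (b \ot g) =
    tsum (comul h) (fun h1 h2 => twalg_mul a (actH h1 b) \ot (h2 * g)).
  exact: (@smash_mulE R H twmod).
have mulHJE a (h : H) b (g : H) : mulHJ (a \ot h) (b \ot g) =
    tsum (J * comul h * Q) (fun h1 h2 => (a * actH h1 b) \ot (h2 * g)).
  exact: (@smash_mulE R (twisted_hopf T) A).
move=> s t; change (tens_act J (mulH s t) = mulHJ (tens_act J s) (tens_act J t)).
move: s; apply: lin_ext; [lin|lin|move=> a h].
move: t; apply: lin_ext; [lin|lin|move=> b g].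
have bm := twalg_mul_bilin.
transitivity (tsum J (fun x y => tsum (J * comul y) (fun v w =>
  tsum (comul h) (fun h1 h2 =>
    (actH x a * actH v (actH h1 b)) \ot (w * (h2 * g)))))).
  rewrite -cocycle_tsum; try by lin.
  rewrite mulHE (lin_tsum_comp (f := tens_act J)); last by lin.
  under [RHS]eq_tsum => x w do rewrite tsum_comm.
  rewrite tsum_comm; apply: eq_tsum => h1 h2.
  rewrite tens_act_pure; apply: eq_tsum => x w.
  rewrite actH_twalg_mul_act2 /act2.
  by rewrite (lin_tsum_comp (f := fun z : A => z \ot _)); last by lin.
rewrite [tens_act J (a \ot h)]tens_act_pure.
rewrite (lin_tsum_comp (f := mulHJ^~ _)); last by lin.
apply: eq_tsum => x y; rewrite tens_act_pure.
rewrite (lin_tsum_comp (f := mulHJ _)); last by lin.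
under [RHS]eq_tsum => x' y' do rewrite mulHJE.
(* The last [J] comes from the image of [b \ot g]. It cancels the [Q] of the twisted coproduct and
   leaves J Delta(y) Delta(h). *)
transitivity (tsum (J * comul (y * h) * Q * J)
  (fun v w => (actH x a * actH v b) \ot (w * g))).
  rewrite -[X in _ = tsum X _]mulrA twistVK mulr1 comulM mulrA.
  rewrite [RHS]tsum_mul; last by lin.
  by do 2!apply: eq_tsum => ? ?; rewrite actHM mulrA.
rewrite tsum_mul; last by lin.
rewrite tsum_comm; do 2!apply: eq_tsum => ? ?.
by rewrite actHM mulrA.
Qed.

(** Again the first leg of [J] acts on 1 through the counit, and [twist_counit_l] evaluates what
    remains. *)
Lemma smash_twist1 : smash_twist 1 = 1.
Proof.
have ba := actH_bilin.
rewrite /smash_twist -[X in tens_act J X]/((1 : A) \ot (1 : H)) tens_act_pure.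
under eq_tsum => x y do rewrite actH_one mulr1.
rewrite -[RHS]/((1 : A) \ot (1 : H)) -(twist_counit_l T).
rewrite (lin_tsum_comp (f := pure (1 : A))); last by lin.
have bp := @pure_bilin R A H.
apply: eq_tsum => x y.
by rewrite (proj2 (bilin_l y bp)) (proj2 (bilin_r (1 : A) bp)).
Qed.

Lemma twisted_smash_semiprime : semiprime (smash twmod) -> semiprime (smash A).
Proof.
have lt : is_lin (tens_act J) := bilin_r J tens_act_bilin.
apply: (semiprime_bij (f := smash_twist) (g := smash_untwist)).
- exact: (proj1 lt).
- exact: smash_twistM.
- exact: (lin0 lt).
- exact: smash_twist1.
- exact: smash_twistK.
- exact: smash_untwistK.
Qed.

End TwistedModuleAlgebra.

Theorem corollary5p4 (R : comPzRingType) (H : hopfAlg R)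
    (J : drinfeldTwist H) :
  strongly_semisimple H -> strongly_semisimple (twisted_hopf J).
Proof.
move=> ssH A sA; apply: twisted_smash_semiprime.
by apply: ssH; apply: twmod_semiprime.
Qed.
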